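(* Let $G$ and $H$ be connected finite simple graphs, each with at least two vertices. Then $$\sigma(G\Box H)\geq \sigma(G)+\sigma(H)-1.$$ Moreover, this lower bound is sharp: there exist connected finite simple graphs $G$ and $H$, each with at least two vertices, such that $\sigma(G\Box H)=\sigma(G)+\sigma(H)-1$.
   Context: All graphs are undirected, finite and simple. For a graph $G$, the spanning tree packing number $\sigma(G)$ is the maximum number of pairwise edge-disjoint spanning trees contained in $G$. The Cartesian product $G\Box H$ is the graph with vertex set $V(G)\times V(H)$ in which two vertices $(u,v)$ and $(u',v')$ are adjacent if and only if either $u=u'$ and $vv'\in E(H)$, or $v=v'$ and $uu'\in E(G)$. *)

(* Defs.v *)
From mathcomp Require Import all_boot.

Set Implicit Arguments.
Unset Strict Implicit.
Unset Printing Implicit Defensive.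

Record sgraph := SGraph {
  vertex :> finType;
  adj : rel vertex;
  adj_sym : symmetric adj;
  adj_irr : irreflexive adj }.

Definition edges (G : sgraph) : {set {set G}} :=
  [set e | [exists x : G, exists y : G, adj x y && (e == [set x; y])]].

Definition connected (G : sgraph) : bool :=
  (0 < #|G|) && [forall x : G, forall y : G, connect (@adj G) x y].

(* A cycle is a repetition-free cyclic sequence of at least three vertices,
   hence of at most #|G|; acyclicP removes this bound on the length. *)
Definition acyclic (G : sgraph) : bool :=
  [forall n : 'I_#|G|.+1, forall c : n.-tuple G,
     (2 < n) ==> ~~ ucycleb (@adj G) c].

Lemma acyclicP (G : sgraph) :
  reflect (forall c : seq G, 2 < size c -> ~ ucycle (@adj G) c) (acyclic G).
Proof.
apply: (iffP idP) => [acG c c_gt2 c_cyc | acG].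
  have c_le : size c < #|G|.+1.
    by case/andP: c_cyc => _ /card_uniqP <-; rewrite ltnS max_card.
  move/forallP: acG => /(_ (Ordinal c_le)) /forallP /(_ (in_tuple c)).
  by move=> /implyP /(_ c_gt2) /negP; apply.
apply/forallP=> n; apply/forallP=> c; apply/implyP=> n_gt2.
by apply/negP; apply: acG; rewrite size_tuple.
Qed.

Definition is_tree (G : sgraph) : bool := connected G && acyclic G.

Section SpanningSubgraph.
Variables (G : sgraph) (F : {set {set G}}).

Definition span_adj : rel G := fun x y => adj x y && ([set x; y] \in F).

Lemma span_adj_sym : symmetric span_adj.
Proof. by move=> x y; rewrite /span_adj adj_sym setUC. Qed.

Lemma span_adj_irr : irreflexive span_adj.
Proof. by move=> x; rewrite /span_adj adj_irr. Qed.

Definition spanning_subgraph : sgraph := SGraph span_adj_sym span_adj_irr.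

End SpanningSubgraph.

Definition spanning_tree (G : sgraph) (F : {set {set G}}) : bool :=
  (F \subset edges G) && is_tree (spanning_subgraph F).

Definition tree_packing (G : sgraph) (P : {set {set {set G}}}) : bool :=
  [forall F in P, spanning_tree F] && trivIset P.

(* On at least two vertices spanning trees have nonempty edge sets, so pairwise
   edge-disjoint ones are distinct and a set of trees loses no multiplicity. On
   one vertex the value is 1. *)
Definition sigma (G : sgraph) : nat :=
  \max_(P : {set {set {set G}}} | tree_packing P) #|P|.

Section CartesianProduct.
Variables G H : sgraph.

Definition cart_adj : rel (G * H)%type := fun p q =>
  ((p.1 == q.1) && adj p.2 q.2) || ((p.2 == q.2) && adj p.1 q.1).

Lemma cart_adj_sym : symmetric cart_adj.
Proof.
move=> p q; rewrite /cart_adj (eq_sym p.1) (eq_sym p.2).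
by rewrite (adj_sym p.1) (adj_sym p.2).
Qed.

Lemma cart_adj_irr : irreflexive cart_adj.
Proof. by move=> p; rewrite /cart_adj !adj_irr !andbF. Qed.

Definition cart_prod : sgraph := SGraph cart_adj_sym cart_adj_irr.

End CartesianProduct.

Notation "G □ H" := (cart_prod G H) (at level 40, left associativity).

(* Main.v *)
Require Import Defs.
From mathcomp Require Import all_boot.
From mathcomp Require Import zify.

Set Implicit Arguments.
Unset Strict Implicit.
Unset Printing Implicit Defensive.

(** Edge-disjoint spanning trees may be replaced by edge-disjoint connected
    spanning subgraphs, because every connected spanning subgraph contains a
    spanning tree.  A family of such subgraphs is recorded by an edge colouring
    [c], the [i]-th subgraph being the colour class of [i] ([packs]; lemmas
    [packs_sigma] and [packs_le_sigma]).

    Let [k = sigma G] and [l = sigma H], with colour classes T_0, ..., T_(k-1)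
    of G and S_0, ..., S_(l-1) of H.  Inside T_0 and S_0 choose rooted spanning
    trees, given by parent maps [pG] and [pH].  In the product, the subgraph
    of colour i, for 0 < i < k, contains all copies of T_i, linked together
    by one copy of each parent edge {v, pH v}; likewise for each j with
    0 < j < l a subgraph contains all copies of S_j and one copy of each parent
    edge {u, pG u}.  The last of the k + l - 1 subgraphs is made of copies of
    parent edges that are not given away to these subgraphs, and it is connected
    as soon as every vertex (u, v) other than the root keeps its edge to
    (pG u, v) or its edge to (u, pH v) ([packs_cart]).

    To achieve this, number the vertices of G and of H from 0, the roots getting
    the number 0.  The copy of {v, pH v} over the vertex u is given away only if
    the numbers of u and v have the same parity, and then to the colour that is
    half the number of u, rounded down; the copy of {u, pG u} over v is given
    away only if the parities differ, to the colour determined by half the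
    number of v.  So no vertex (u, v) loses both edges, and the copies over the
    roots, whose half-number is 0, are all kept.  Every needed colour occurs
    because 2k <= |G| and 2l <= |H|, which follows from counting edges
    ([packs_card]).

    For sharpness, take G and H to be the complete graph on two vertices: the
    product is a 4-cycle, which has too few edges for two spanning trees. *)

(** * Connectivity *)

(** Connectivity follows from that of the fibres of a map [f], when each
    fibre but one has a link to a fibre of smaller height. *)
Lemma connect_fibers (T V : finType) (e : rel T) (f : T -> V) (s : V)
    (d : V -> nat) :
  symmetric e ->
  (forall x y, f x = f y -> connect e x y) ->
  (forall v, v != s -> exists x y, [/\ f x = v, e x y & d (f y) < d v]) ->
  forall x y, connect e x y.
Proof.
move=> sym_e fib link.
have to_s x : exists2 x', f x' = s & connect e x x'.
  have [n] := ubnP (d (f x)); elim: n x => // n IHn x le_n.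
  have [fx_s | /link[y [z [fy e_yz lt_d]]]] := eqVneq (f x) s; first by exists x.
  have [|x' fx' z_x'] := IHn z; first exact: leq_trans lt_d le_n.
  exists x' => //; apply: connect_trans (fib x y _) _; first by rewrite fy.
  exact: connect_trans (connect1 e_yz) z_x'.
move=> x y; have [x' fx' x_x'] := to_s x; have [y' fy' y_y'] := to_s y.
apply: connect_trans x_x' _; apply: connect_trans (fib x' y' _) _.
  by rewrite fx' fy'.
by rewrite (sym_connect_sym sym_e).
Qed.

(** A connected graph has a rooted spanning tree, given by a parent map [p]
    and a depth function [d]. *)
Lemma connect_parent (T : finType) (e : rel T) (r : T) :
  (forall x, connect e x r) ->
  exists (p : T -> T) (d : T -> nat),
    forall x, x != r -> e x (p x) /\ d (p x) < d x.
Proof.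
move=> conn.
have ex_n x : exists n, [exists t : n.-tuple T, path e x t && (last x t == r)].
  have /connectP[t et lt] := conn x.
  by exists (size t); apply/existsP; exists (in_tuple t); rewrite et -lt /=.
pose d x := ex_minn (ex_n x).
exists (fun x => odflt x [pick y | e x y && (d y < d x)]), d => x x_r.
case: pickP => [y /andP[]//|no_y] /=.
have : exists2 y, e x y & d y < d x.
  rewrite {2}/d; case: ex_minnP => n /existsP[t /andP[et lt]] _.
  case: n t et lt => [|n] t; first by rewrite tuple0 /= (negPf x_r).
  case/tupleP: t => y t /= /andP[e_xy et] lt; exists y => //.
  rewrite /d; case: ex_minnP => m _; apply.
  by apply/existsP; exists t; rewrite et.
by case=> y e_xy lt_d; have:= no_y y; rewrite e_xy lt_d.
Qed.

(** * Packings of connected spanning subgraphs as edge colourings *)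

(** The subgraph of colour [i], for a colouring [c] of the edges of [G]. *)
Definition color_class (G : sgraph) (c : G -> G -> nat) (i : nat) : rel G :=
  fun x y => adj x y && (c x y == i).

(** The colours below [k] of the edge colouring [c] are connected spanning
    subgraphs, which are edge-disjoint by construction.  Colours from [k] on are
    allowed; the values of [c] on pairs that are not edges are irrelevant,
    but are also required to be symmetric. *)
Definition packs (G : sgraph) (k : nat) (c : G -> G -> nat) : Prop :=
  (forall x y, c x y = c y x) /\
  (forall i, i < k -> forall x y, connect (color_class c i) x y).

Lemma color_class_sym (G : sgraph) k (c : G -> G -> nat) i :
  packs k c -> symmetric (color_class c i).
Proof. by case=> sym_c _ x y; rewrite /color_class adj_sym sym_c. Qed.

Lemma packs_sigma (G : sgraph) : exists c, packs (sigma G) (c : G -> G -> nat).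
Proof.
have packs0 : 0 < #|[pred P : {set {set {set G}}} | tree_packing P]|.
  apply/card_gt0P; exists set0; rewrite inE; apply/andP; split.
    by apply/forallP=> F; rewrite inE.
  by apply/trivIsetP=> A B; rewrite inE.
rewrite /sigma.
have [P packP ->] := eq_bigmax_cond (fun P : {set {set {set G}}} => #|P|) packs0.
move: packP; rewrite inE => /andP[/forall_inP trees /trivIsetP disjP].
exists (fun x y => find (fun F : {set {set G}} => [set x; y] \in F) (enum P)).
split=> [x y | i lt_i x y]; first by rewrite setUC.
have lt_i' : i < size (enum P) by rewrite -cardE.
set F := nth set0 (enum P) i.
have FP : F \in P by rewrite -mem_enum mem_nth.
have /andP[_ /andP[/andP[_ connF] _]] := trees F FP.
have /forallP/(_ x)/forallP/(_ y) := connF.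
apply: connect_sub => {}x {}y /andP[adj_xy xyF]; apply/connect1.
rewrite /color_class adj_xy /=; apply/eqP.
set a := fun _ => _.
have has_a : has a (enum P).
  by apply/hasP; exists F => //; rewrite mem_enum.
have a_nth := nth_find set0 has_a; rewrite has_find in has_a.
set F' := nth set0 _ (find a _) in a_nth.
have F'P : F' \in P by rewrite -mem_enum mem_nth.
have eqF : F' = F.
  apply/eqP; apply: contraTT a_nth => /(disjP _ _ F'P FP)/pred0P/(_ [set x; y]).
  by rewrite /= /a xyF andbT => ->.
by apply/eqP; rewrite -(nth_uniq set0 has_a lt_i' (enum_uniq _)); apply/eqP.
Qed.

(** A minimal connected spanning subgraph is acyclic: the other edges of a
    cycle connect the ends of the edge that is removed. *)
Lemma spanning_tree_sub (G : sgraph) (F : {set {set G}}) :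
  F \subset edges G -> connected (spanning_subgraph F) ->
  exists2 E : {set {set G}}, E \subset F & spanning_tree E.
Proof.
move=> F_edges connF.
have [E minE sEF] := @minset_exists _
  (fun E : {set {set G}} => connected (spanning_subgraph E)) F connF.
have [/= connE minimal] := minsetP minE.
exists E => //; rewrite /spanning_tree (subset_trans sEF F_edges) /is_tree connE.
apply/acyclicP=> -[|x [|y [|z s]]] // _ /andP[/=].
case/and3P=> /andP[_ xyE] yzE path_z /and3P[x_yzs y_zs _].
move: x_yzs; rewrite !inE !negb_or => /and3P[x_y x_z x_s].
move: y_zs; rewrite !inE !negb_or => /andP[y_z y_s].
have neq_xy (a b : G) : a != y -> b != y -> [set a; b] != [set x; y].
  move=> ay byy; apply/eqP=> /setP/(_ y); rewrite !inE eqxx orbT.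
  by rewrite eq_sym (negPf ay) eq_sym (negPf byy).
pose E' := E :\ [set x; y].
have yx : connect (span_adj E') y x.
  apply/connectP; exists (z :: rcons s x); last by rewrite /= last_rcons.
  rewrite /=; apply/andP; split.
    case/andP: yzE => adj_yz yzE; rewrite /span_adj adj_yz inE yzE inE andbT.
    apply/eqP=> /setP/(_ x); rewrite !inE eqxx (negPf x_y) (negPf x_z).
    by [].
  apply: (@sub_in_path _ (predC1 y) (span_adj E)) path_z.
    move=> a b a_y b_y /andP[adj_ab abE].
    by rewrite /span_adj adj_ab !inE abE andbT neq_xy.
  rewrite /= eq_sym y_z all_rcons /= x_y /=.
  by apply/allP=> w ws; apply: contraNneq y_s => <-.
have connE' : connected (spanning_subgraph E').
  case/andP: connE => G0 /forallP conn; apply/andP; split=> //.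
  apply/forallP=> a; apply/forallP=> b; have /forallP/(_ b) := conn a.
  apply: connect_sub => {}a {}b /andP[adj_ab abE].
  have [ab_xy | ab_xy] := eqVneq [set a; b] [set x; y]; last first.
    by apply: connect1; rewrite /= /span_adj adj_ab !inE ab_xy.
  have a_b : a != b by apply: contraTneq adj_ab => ->; rewrite adj_irr.
  have xy : connect (span_adj E') x y.
    by rewrite (sym_connect_sym (@span_adj_sym G E')).
  have : a \in [set x; y] by rewrite -ab_xy !inE eqxx.
  have : b \in [set x; y] by rewrite -ab_xy !inE eqxx orbT.
  rewrite !inE => /orP[]/eqP eb /orP[]/eqP ea; move: a_b; rewrite ea eb ?eqxx //.
have /setP/(_ [set x; y]) := minimal E' connE' (subsetDl _ _).
by rewrite !inE eqxx xyE.
Qed.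

Lemma packs_le_sigma (G : sgraph) k (c : G -> G -> nat) :
  1 < #|G| -> packs k c -> k <= sigma G.
Proof.
move=> G_gt1 pack_c; have [sym_c conn_c] := pack_c.
pose F (i : 'I_k) : {set {set G}} :=
  [set e | [exists x : G, exists y : G, color_class c i x y && (e == [set x; y])]].
have ex_tree i : exists E : {set {set G}}, E \subset F i /\ spanning_tree E.
  suff [E] : exists2 E : {set {set G}}, E \subset F i & spanning_tree E.
    by exists E.
  apply: spanning_tree_sub.
    apply/subsetP=> e; rewrite !inE => /existsP[x /existsP[y /andP[/andP[xy _] e_xy]]].
    by apply/existsP; exists x; apply/existsP; exists y; rewrite xy.
  apply/andP; split; first exact: ltnW.
  apply/forallP=> x; apply/forallP=> y; have:= conn_c i (ltn_ord i) x y.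
  apply: connect_sub => {}x {}y xy_i; apply: connect1.
  rewrite /= /span_adj; case/andP: (xy_i) => -> _ /=; rewrite inE.
  by apply/existsP; exists x; apply/existsP; exists y; rewrite xy_i eqxx.
have [E EP] := fin_all_exists ex_tree.
have F_color i (x y : G) : [set x; y] \in F i -> c x y = i.
  rewrite inE => /existsP[a /existsP[b /andP[/andP[adj_ab /eqP<-] /eqP xy_ab]]].
  have a_b : a != b by apply: contraTneq adj_ab => ->; rewrite adj_irr.
  have : a \in [set x; y] by rewrite xy_ab !inE eqxx.
  have : b \in [set x; y] by rewrite xy_ab !inE eqxx orbT.
  rewrite !inE => /orP[]/eqP eb /orP[]/eqP ea; move: a_b; rewrite ea eb ?eqxx //.
have disjE i j e : e \in E i -> e \in E j -> i = j.
  have [[sEF _] [sEF' _]] := (EP i, EP j).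
  move=> /(subsetP sEF) ei /(subsetP sEF') ej.
  have := ei; rewrite inE => /existsP[x /existsP[y /andP[_ /eqP e_xy]]].
  by apply: val_inj; rewrite /= -(F_color i x y) -?(F_color j x y) -?e_xy.
(* Spanning trees have an edge because G has at least two vertices. *)
have E_neq0 i : exists e, e \in E i.
  have [_ /andP[_ /andP[/andP[_ conn] _]]] := EP i.
  have [x [y [_ _ x_y]]] := card_gt1P G_gt1.
  have /forallP/(_ x)/forallP/(_ y)/connectP[[|z s] /=] := conn.
    by move=> _ eq_yx; rewrite eq_yx eqxx in x_y.
  by case/andP=> /andP[_ e_xz] _ _; exists [set x; z].
have inj_E : injective E.
  move=> i j eq_E; have [e ei] := E_neq0 i.
  by apply: (disjE i j e) => //; rewrite -eq_E.
rewrite -[leqLHS]card_ord -(card_imset _ inj_E).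
apply: (@leq_bigmax_cond _ (@tree_packing G)
                         (fun P : {set {set {set G}}} => #|P|)).
apply/andP; split; first by apply/forall_inP=> _ /imsetP[i _ ->]; case: (EP i).
apply/trivIsetP=> _ _ /imsetP[i _ ->] /imsetP[j _ ->] Ei_j.
apply/pred0P=> e /=; apply: contra_neqF Ei_j => /andP[ei ej].
by rewrite (disjE i j e).
Qed.

Lemma sigma_gt0 (G : sgraph) : connected G -> 1 < #|G| -> 0 < sigma G.
Proof.
move=> /andP[_ /forallP conn] G_gt1.
apply: (@packs_le_sigma G 1 (fun _ _ => 0)) => //; split=> // i lt_i x y.
have /forallP/(_ y) := conn x; apply: connect_sub => a b ab.
by apply: connect1; rewrite /color_class ab; case: i lt_i.
Qed.

(** * Counting edges *)

(** The set of ordered pairs of adjacent vertices; each edge occurs twice. *)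
Definition darts (G : sgraph) : {set G * G} := [set q | adj q.1 q.2].

Lemma color_class_card (G : sgraph) k (c : G -> G -> nat) i :
  packs k c -> i < k ->
  #|G|.-1 * 2 <= #|[set q in darts G | c q.1 q.2 == i]|.
Proof.
move=> pack_c lt_i; have [sym_c /(_ i lt_i) conn] := pack_c.
have [-> //|/card_gt0P[r _]] := posnP #|G|.
have [p [d pd]] := connect_parent (fun x => conn x r).
pose U := [set (u, p u) | u in predC1 r]; pose D := [set (p u, u) | u in predC1 r].
have cardU : #|U| = #|G|.-1.
  by rewrite card_imset ?cardC1 // => u v [].
have cardD : #|D| = #|G|.-1.
  by rewrite card_imset ?cardC1 // => u v [].
have disjUD : U :&: D = set0.
  apply/setP=> q; rewrite !inE; apply/negbTE/negP => /andP[].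
  case/imsetP=> u /pd[_ lt_u] -> /imsetP[v /pd[_ lt_v] [u_pv pu_v]].
  by move: lt_u lt_v; rewrite pu_v -u_pv; lia.
have -> : #|G|.-1 * 2 = #|U :|: D| by rewrite cardsU disjUD cards0 cardU cardD; lia.
apply/subset_leq_card/subsetP=> q; rewrite !inE => /orP[] /imsetP[u /pd[]].
  by case/andP=> adj_u c_u _ ->; rewrite /= adj_u.
by case/andP=> adj_u c_u _ ->; rewrite /= adj_sym adj_u sym_c.
Qed.

Lemma packs_card_darts (G : sgraph) k (c : G -> G -> nat) :
  packs k c -> k * (#|G|.-1 * 2) <= #|darts G|.
Proof.
case: k => // k pack_c.
rewrite -sum1_card (partition_big (fun q => inord (c q.1 q.2) : 'I_k.+1) xpredT) //=.
rewrite -[k.+1 in leqLHS]card_ord -sum_nat_const leq_sum // => i _.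
rewrite sum1_card; apply: leq_trans (color_class_card pack_c (ltn_ord i)) _.
apply/subset_leq_card/subsetP=> q; rewrite !inE unfold_in => /andP[q_dart /eqP->].
by rewrite inE q_dart inord_val eqxx.
Qed.

Lemma card_darts (G : sgraph) : #|darts G| <= #|G| * #|G|.-1.
Proof.
pose diag := [set (x, x) | x : G].
have card_diag : #|diag| = #|G| by rewrite card_imset // => x y [].
have : #|darts G| <= #|~: diag|.
  apply/subset_leq_card/subsetP=> -[x y]; rewrite !inE /= => xy.
  by apply: contraTN xy => /imsetP[z _ [-> ->]]; rewrite adj_irr.
by have := cardsC diag; rewrite card_prod card_diag; nia.
Qed.

Lemma packs_card (G : sgraph) k (c : G -> G -> nat) :
  1 < #|G| -> packs k c -> k.*2 <= #|G|.
Proof.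
move=> G_gt1 /packs_card_darts le_k; have := leq_trans le_k (card_darts G).
by nia.
Qed.

(** * The lower bound *)

(** The end of an edge [{x, y}] that is farther from the root, in a rooted tree
    with depth function [d]; [r] is a default value for ends of equal depth. *)
Definition child (T : Type) (d : T -> nat) (r x y : T) : T :=
  if d y < d x then x else if d x < d y then y else r.

Lemma childC (T : Type) (d : T -> nat) r x y : child d r x y = child d r y x.
Proof. by rewrite /child; case: ltngtP. Qed.

Lemma child_parent (T : Type) (d : T -> nat) r x y :
  d y < d x -> child d r x y = x.
Proof. by rewrite /child => ->. Qed.

Lemma enum_rank_surj (T : finType) t :
  t < #|T| -> exists x : T, enum_rank x = t :> nat.
Proof. by move=> lt_t; exists (enum_val (Ordinal lt_t)); rewrite enum_valK. Qed.

(** The numbering of the vertices is [enum_rank].  Besides the needed edges, the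
    colour classes may contain further ones, as a class only has to be
    connected. *)
Lemma packs_cart (G H : sgraph) k l cG cH :
  k.+1.*2 <= #|G| -> l.+1.*2 <= #|H| ->
  @packs G k.+1 cG -> @packs H l.+1 cH -> exists c, @packs (G □ H) (k + l).+1 c.
Proof.
move=> le_k le_l pack_G pack_H.
have [[symG connG] [symH connH]] := (pack_G, pack_H).
have [|r r0] := @enum_rank_surj G 0; first by lia.
have [|s s0] := @enum_rank_surj H 0; first by lia.
have [pG [dG pdG]] := connect_parent (fun x => connG 0 isT x r).
have [pH [dH pdH]] := connect_parent (fun x => connH 0 isT x s).
(* The colour of the copy over v of the edge from u to its parent, and that of
   the copy over u of the edge from v to its parent. *)
pose mG (u : G) (v : H) :=
  if odd (enum_rank u) != odd (enum_rank v) then (enum_rank v)./2 else 0.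
pose mH (u : G) (v : H) :=
  if odd (enum_rank u) == odd (enum_rank v) then (enum_rank u)./2 else 0.
(* The nonzero colours of H follow those of G in the product. *)
pose shift j := if j == 0 then 0 else k + j.
pose c (p q : G □ H) :=
  if p.2 == q.2 then
    if cG p.1 q.1 == 0 then shift (mG (child dG r p.1 q.1) p.2)
    else cG p.1 q.1
  else
    if cH p.2 q.2 == 0 then mH p.1 (child dH s p.2 q.2)
    else shift (cH p.2 q.2).
(* [c] is symmetric on edges only: pairs that differ in both coordinates must
   be given a common colour. *)
pose c' (p q : G □ H) := if adj p q then c p q else 0.
have sym_c' p q : c' p q = c' q p.
  rewrite /c' (adj_sym q); case: ifP => // pq; rewrite /c eq_sym.
  case: (q.2 =P p.2) => [->|neq]; first by rewrite symG childC.
  rewrite symH childC; congr (if _ then mH _ _ else _).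
  by case/orP: pq => /andP[/eqP] // e; case: neq.
exists c'.
have hor i (u u' : G) v : adj u u' ->
    (if cG u u' == 0 then shift (mG (child dG r u u') v) else cG u u') = i ->
    color_class c' i ((u, v) : G □ H) (u', v).
  move=> uu' <-; have adj' : adj ((u, v) : G □ H) (u', v).
    by rewrite /= /cart_adj /= eqxx uu' orbT.
  by rewrite /color_class adj' /c' adj' /c /= eqxx.
have ver i u (v v' : H) : adj v v' ->
    (if cH v v' == 0 then mH u (child dH s v v') else shift (cH v v')) = i ->
    color_class c' i ((u, v) : G □ H) (u, v').
  move=> vv' <-; have adj' : adj ((u, v) : G □ H) (u, v').
    by rewrite /= /cart_adj /= eqxx vv'.
  have v_v' : v != v' by apply: contraTneq vv' => ->; rewrite adj_irr.
  by rewrite /color_class adj' /c' adj' /c /= (negPf v_v').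
have hor_parent u v : u != r ->
    color_class c' (shift (mG u v)) ((u, v) : G □ H) (pG u, v).
  move=> /pdG[/andP[adj_u c_u] d_u]; apply: hor => //.
  by rewrite c_u child_parent.
have ver_parent u v : v != s ->
    color_class c' (mH u v) ((u, v) : G □ H) (u, pH v).
  move=> /pdH[/andP[adj_v c_v] d_v]; apply: ver => //.
  by rewrite c_v child_parent.
split=> // i lt_i.
have sym_i : symmetric (color_class c' i).
  by move=> x y; rewrite /color_class adj_sym sym_c'.
have lift_connect (T : finType) (e : rel T) (g : T -> G □ H) x y :
    (forall a b, e a b -> color_class c' i (g a) (g b)) ->
    connect e x y -> connect (color_class c' i) (g x) (g y).
  move=> eg /connectP[t et ->]; elim: t x et => //= z t IHt x /andP[xz zt].
  exact: connect_trans (connect1 (eg _ _ xz)) (IHt _ zt).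
case: (posnP i) => [i0 | i_gt0].
  (* Colour 0: each vertex but the root keeps an edge to a smaller depth. *)
  apply: (@connect_fibers _ _ _ id (r, s) (fun x => dG x.1 + dH x.2)) => //.
    by move=> x y /= ->.
  move=> [u v]; rewrite xpair_eqE negb_and => /= not_root; exists (u, v).
  have mG_s w : mG w s = 0 by rewrite /mG s0 if_same.
  have mH_r w : mH r w = 0 by rewrite /mH r0 if_same.
  have [[u_r mG0] | not_hor] : (u != r /\ mG u v = 0) \/ (v != s /\ mH u v = 0).
  - have [u_r | u_r] := eqVneq u r.
      by right; rewrite u_r mH_r; move: not_root; rewrite u_r eqxx.
    have [v_s | v_s] := eqVneq v s; first by left; rewrite v_s.
    by rewrite /mG /mH; case: eqP; [left | right].
  - exists (pG u, v); split=> //=; last by have [_] := pdG u u_r; lia.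
    by rewrite i0; have := hor_parent u v u_r; rewrite mG0.
  - have [v_s mH0] := not_hor; exists (u, pH v); split=> //=.
      by rewrite i0; have := ver_parent u v v_s; rewrite mH0.
    by have [_] := pdH v v_s; lia.
have [i_le_k | k_lt_i] := leqP i k.
  (* Colours of G: the fibres are the copies of G. *)
  apply: (@connect_fibers _ H _ snd s dH) => //.
    case=> u v [u' v'] /= <-.
    apply: (lift_connect _ _ (fun w => (w, v) : G □ H)) (connG i _ u u'); last by [].
    move=> a b /andP[adj_ab /eqP c_ab]; apply: hor => //.
    by rewrite c_ab; case: i i_gt0 {lt_i sym_i lift_connect i_le_k c_ab}.
  (* The edge from v to its parent has the colour i over the vertex u whose
     number is 2i or 2i + 1, with the parity of the number of v. *)
  move=> v v_s; have [|u rank_u] := @enum_rank_surj G (odd (enum_rank v) + i.*2).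
    by case: (odd _); lia.
  exists (u, v), (u, pH v); split=> //=; last by case: (pdH v v_s).
  suff <- : mH u v = i by exact: ver_parent.
  by rewrite /mH rank_u oddD odd_double addbF oddb eqxx half_bit_double.
(* Colours of H: the fibres are the copies of H. *)
have [j [j_gt0 j_lt def_i]] : exists j, [/\ 0 < j, j < l.+1 & shift j = i].
  by exists (i - k); split; rewrite /shift; [lia | lia | case: eqP; lia].
apply: (@connect_fibers _ G _ fst r dG) => //.
  case=> u v [u' v'] /= <-.
  apply: (lift_connect _ _ (fun w => (u, w) : G □ H)) (connH j _ v v'); last by [].
  move=> a b /andP[adj_ab /eqP c_ab]; apply: ver => //.
  by rewrite c_ab def_i; case: j j_gt0 {j_lt def_i c_ab}.
(* Here the number of v is 2j or 2j + 1, and its parity is not that of u. *)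
move=> u u_r.
have [|v rank_v] := @enum_rank_surj H (~~ odd (enum_rank u) + j.*2).
  by case: (~~ odd _); lia.
exists (u, v), (pG u, v); split=> //=; last by case: (pdG u u_r).
suff <- : shift (mG u v) = i by exact: hor_parent.
rewrite /mG rank_v oddD odd_double addbF oddb half_bit_double.
by rewrite -def_i; case: (odd _).
Qed.

Lemma sigma_cart_ge (G H : sgraph) :
  connected G -> connected H -> 1 < #|G| -> 1 < #|H| ->
  sigma G + sigma H - 1 <= sigma (G □ H).
Proof.
move=> connG connH G_gt1 H_gt1.
have [cG] := packs_sigma G; have [cH] := packs_sigma H.
have := sigma_gt0 connH H_gt1; have := sigma_gt0 connG G_gt1.
case: (sigma G) (sigma H) => // k [//|l] _ _ pack_H pack_G.
have [c pack_c] := packs_cart (packs_card G_gt1 pack_G) (packs_card H_gt1 pack_H)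
                              pack_G pack_H.
rewrite addSn addnS subn1 /=; apply: packs_le_sigma pack_c.
by rewrite /= card_prod; nia.
Qed.

(** * Sharpness *)

Lemma neq_sym (T : eqType) : symmetric (fun x y : T => x != y).
Proof. by move=> x y; rewrite eq_sym. Qed.

Lemma neq_irr (T : eqType) : irreflexive (fun x y : T => x != y).
Proof. by move=> x; rewrite eqxx. Qed.

(** The complete graph on two vertices. *)
Definition K2 : sgraph := SGraph (@neq_sym bool) (@neq_irr bool).

Lemma connected_K2 : connected K2.
Proof.
apply/andP; split; first by rewrite card_bool.
apply/forallP=> x; apply/forallP=> y.
have [-> | x_y] := eqVneq x y; first exact: connect0.
exact: (@connect1 _ (@adj K2)).
Qed.

Lemma sigma_K2 : sigma K2 = 1.
Proof.
have K2_gt1 : 1 < #|K2| by rewrite card_bool.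
have [c /(packs_card K2_gt1)] := packs_sigma K2.
by have := sigma_gt0 connected_K2 K2_gt1; rewrite card_bool; lia.
Qed.

(** A dart of the 4-cycle is determined by its origin and its direction. *)
Lemma card_darts_K2_K2 : #|darts (K2 □ K2)| <= 8.
Proof.
pose f (q : (K2 □ K2) * (K2 □ K2)) : bool * bool * bool := (q.1, q.1.1 == q.2.1).
have inj_f : {in darts (K2 □ K2) &, injective f}.
  move=> [[a b] [a' b']] [[x y] [x' y']]; rewrite !inE /= /cart_adj /f /=.
  move=> ab xy [eq_a eq_b]; move: ab xy; rewrite eq_a eq_b.
  by case: x x' a' y y' b' {eq_a eq_b} => [] [] [] [] [] [].
rewrite -(card_in_imset inj_f) (leq_trans (max_card _)) //.
by rewrite !card_prod !card_bool.
Qed.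

Lemma sigma_K2_K2 : sigma (K2 □ K2) <= 1.
Proof.
have [c /packs_card_darts] := packs_sigma (K2 □ K2).
by have := card_darts_K2_K2; rewrite card_prod card_bool; lia.
Qed.

Theorem theorem1 :
  (forall G H : sgraph,
     connected G -> connected H -> 1 < #|G| -> 1 < #|H| ->
     sigma G + sigma H - 1 <= sigma (G □ H)) /\
  (exists G H : sgraph,
     [/\ connected G, connected H, 1 < #|G|, 1 < #|H| &
         sigma (G □ H) = sigma G + sigma H - 1]).
Proof.
split; first exact: sigma_cart_ge.
have K2_gt1 : 1 < #|K2| by rewrite card_bool.
exists K2, K2; split=> //; try exact: connected_K2.
have := sigma_cart_ge connected_K2 connected_K2 K2_gt1 K2_gt1.
by rewrite sigma_K2; have := sigma_K2_K2; lia.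
Qed.
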